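(* Let $S$ be a polynomial ring in finitely many variables over a field, let $d\ge 1$, and let $I_1,\dots,I_d$ be arbitrary monomial complete intersections in $S$. Then $$\operatorname{reg}(I_1 \cap \cdots \cap I_d) \le \operatorname{reg}(I_1) + \cdots + \operatorname{reg}(I_d).$$
   Context: $S$ carries the standard grading (every variable has degree $1$). For a homogeneous ideal $I$ of $S$ with minimal graded free resolution $0 \to \bigoplus_j S(-b_{mj}) \to \cdots \to \bigoplus_j S(-b_{0j}) \to I \to 0$, the Castelnuovo-Mumford regularity of $I$ is $\operatorname{reg}(I) := \max_{i,j}\{b_{ij}-i \mid i=0,\dots,m\}$ (so that the unit ideal has $\operatorname{reg}(S)=0$). A monomial complete intersection is a nonzero monomial ideal that is a complete intersection, i.e. its minimal monomial generators form a regular sequence (equivalently, they are pairwise coprime). *)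

(* Defs.v *)
From HB Require Import structures.
From mathcomp Require Import all_boot all_order all_algebra.
From mathcomp Require Import mpoly.
From Stdlib Require Import ClassicalEpsilon.

Set Implicit Arguments.
Unset Strict Implicit.
Unset Printing Implicit Defensive.

Import GRing.Theory.
Local Open Scope ring_scope.

Section Ideals.

Variables (K : fieldType) (n : nat).
Local Notation S := {mpoly K[n]}.

Definition ideal_gen (G : S -> Prop) : S -> Prop := fun p =>
  exists (k : nat) (c g : 'I_k -> S),
    (forall i, G (g i)) /\ p = \sum_(i < k) c i * g i.

Definition ideal_seq (s : seq S) : S -> Prop := ideal_gen (fun g => g \in s).

Definition irrelevant_ideal : S -> Prop :=
  ideal_gen (fun g => exists i : 'I_n, g = 'X_i).

(* Each s`_i is a nonzerodivisor on S / (s`_0, ..., s`_(i-1)).  The quotient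
   S / (s) is allowed to vanish, so that the sequence (1) is regular and the
   unit ideal is a complete intersection. *)
Definition regular_seq (s : seq S) : Prop :=
  forall i, (i < size s)%N ->
  forall p : S, ideal_seq (take i s) (s`_i * p) -> ideal_seq (take i s) p.

Definition monomial_ideal (I : S -> Prop) : Prop :=
  exists A : 'X_{1..n} -> Prop,
    forall p, I p <-> ideal_gen (fun g => exists2 m, A m & g = 'X_[m]) p.

Definition monomials (s : seq 'X_{1..n}) : seq S := [seq 'X_[m] | m <- s].

Definition minimal_monomial_generators
    (I : S -> Prop) (s : seq 'X_{1..n}) : Prop :=
  (forall p, I p <-> ideal_seq (monomials s) p) /\
  (forall m, m \in s -> ~ ideal_seq (monomials (rem m s)) 'X_[m]).

Definition monomial_complete_intersection (I : S -> Prop) : Prop :=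
  [/\ monomial_ideal I,
      exists2 p, I p & p != 0
    & exists2 s, minimal_monomial_generators I s & regular_seq (monomials s)].

End Ideals.

Section Regularity.

Variables (K : fieldType) (n : nat).
Local Notation S := {mpoly K[n]}.

Definition homog_of_degree (z : int) (p : S) : Prop :=
  match z with
  | Posz k => p \is k.-homog
  | Negz _ => p = 0
  end.

(* The module in homological degree i is F_i = \bigoplus_(j < rk i) S(-sh i j),
   whose elements are row vectors, its j-th basis vector having degree sh i j.
   The maps F_(i+1) -> F_i and F_0 -> S act by right multiplication. *)
Record free_complex := FreeComplex {
  rk : nat -> nat;
  sh : forall i, 'I_(rk i) -> int;
  diff : forall i, 'M[S]_(rk i.+1, rk i);
  aug : 'cV[S]_(rk 0)
}.

Definition graded (F : free_complex) : Prop :=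
  (forall j, homog_of_degree (sh j) (aug F j ord0)) /\
  (forall i j k, homog_of_degree (sh j - sh k) (diff F i j k)).

Definition finite_length (F : free_complex) : Prop :=
  exists m, forall i, (m < i)%N -> rk F i = 0%N.

Definition resolves (F : free_complex) (I : S -> Prop) : Prop :=
  [/\ forall p, I p <-> exists v : 'rV[S]_(rk F 0), v *m aug F = p%:M,
      forall v : 'rV[S]_(rk F 0),
        v *m aug F = 0 <-> exists w, v = w *m diff F 0
    & forall i (v : 'rV[S]_(rk F i.+1)),
        v *m diff F i = 0 <-> exists w, v = w *m diff F i.+1].

Definition minimal (F : free_complex) : Prop :=
  forall i j k, irrelevant_ideal (diff F i j k).

Definition minimal_graded_free_resolution
    (F : free_complex) (I : S -> Prop) : Prop :=
  [/\ graded F, finite_length F, resolves F I & minimal F].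

Definition is_reg (I : S -> Prop) (r : int) : Prop :=
  exists F : free_complex,
    [/\ minimal_graded_free_resolution F I,
        exists i (j : 'I_(rk F i)), r = sh j - i%:Z
      & forall i (j : 'I_(rk F i)), sh j - i%:Z <= r].

(* Every nonzero homogeneous ideal has a minimal graded free resolution, unique
   up to isomorphism (Hilbert), hence exactly one r with is_reg I r; the value
   0 is only a default for the remaining predicates I. *)
Definition reg (I : S -> Prop) : int :=
  match excluded_middle_informative (exists r, is_reg I r) with
  | left ex_r => proj1_sig (constructive_indefinite_description _ ex_r)
  | right _ => 0
  end.

End Regularity.

(* Main.v *)
(** Following Herzog's generalization of the Taylor complex, a multigraded free
    complex is stored as a complex of K-vector spaces whose basis elements carry
    a multidegree; its part in multidegree [a] is spanned by the basis elements
    whose multidegree divides [x^a], and the complex resolves a monomial ideal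
    as soon as these parts contract to [K] for [x^a] in the ideal and vanish
    otherwise.  Given such complexes for I and J, equip the products of basis
    elements with the lcm of their multidegrees: in each multidegree this is a
    tensor product over K of contractible complexes, so it resolves the
    intersection of I and J, and deg lcm(u, v) <= deg u + deg v bounds its
    shifts.  The minimal resolution of the intersection only has shifts
    occurring in this one.  For a monomial complete intersection the Koszul
    complex is minimal, hence its shifts give the exact regularity. *)

From HB Require Import structures.
Require Import Defs.
From mathcomp Require Import all_boot all_order all_algebra.
From mathcomp Require Import mpoly zify.
From Stdlib Require Import ClassicalEpsilon.

Set Implicit Arguments.
Unset Strict Implicit.
Unset Printing Implicit Defensive.

Import Order.TTheory GRing.Theory Num.Theory.
Local Open Scope ring_scope.

(** * Monomial coefficients and sums against Kronecker deltas *)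

Lemma mnm_neq0P (n : nat) (f : 'X_{1..n}) :
  reflect (exists x, f x != 0%N) (f != 0%MM).
Proof.
apply: (iffP idP) => [h|[x]]; last by apply: contraNneq => ->; rewrite mnm0E.
apply/existsP; apply: contraR h; rewrite negb_exists => /forallP h.
by apply/eqP/mnmP => x; have := h x; rewrite mnm0E negbK => /eqP.
Qed.

Lemma mcoeffMX_if (n : nat) (R : nzRingType) (p : {mpoly R[n]})
    (m c : 'X_{1..n}) :
  (p * 'X_[m])@_c = if (m <= c)%MM then p@_(c - m) else 0.
Proof.
case: ifP => h; first by rewrite -{1}(submK h) addmC mcoeffMX.
apply/eqP; rewrite mcoeff_eq0; apply/negP => hc; move: h.
move: hc; rewrite (perm_mem (msuppMX p m)) => /mapP[m' _ ->].
by rewrite lem_addr.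
Qed.

Lemma sum_deltal (R : comPzRingType) (I : finType) (i : I) (F : I -> R) :
  \sum_x (i == x)%:R * F x = F i.
Proof.
rewrite (bigD1 i) //= eqxx mul1r big1 ?addr0 // => j.
by rewrite eq_sym => /negPf ->; rewrite mul0r.
Qed.

Lemma sum_deltar (R : comPzRingType) (I : finType) (i : I) (F : I -> R) :
  \sum_x F x * (x == i)%:R = F i.
Proof.
rewrite -[RHS](sum_deltal i); apply: eq_bigr => x _.
by rewrite mulrC eq_sym.
Qed.

Lemma sum_sdeltal (R : comPzRingType) (I : finType) (c : R) (i : I)
    (F : I -> R) :
  \sum_x (c * (i == x)%:R) * F x = c * F i.
Proof.
by rewrite -(sum_deltal i F) big_distrr; apply: eq_bigr => x _;
  rewrite /= mulrA.
Qed.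

Lemma sum_sdeltar (R : comPzRingType) (I : finType) (c : I -> R) (i : I)
    (F : I -> R) :
  \sum_x F x * (c x * (x == i)%:R) = F i * c i.
Proof.
rewrite -[RHS](sum_deltar i (fun x => F x * c x)).
by apply: eq_bigr => x _; rewrite mulrA.
Qed.

Lemma sum_mul0r (R : comPzRingType) (I : finType) (F : I -> R) :
  \sum_x 0 * F x = 0.
Proof. by apply: big1 => x _; apply: mul0r. Qed.

Lemma sum_mulr0 (R : comPzRingType) (I : finType) (F : I -> R) :
  \sum_x F x * 0 = 0.
Proof. by apply: big1 => x _; apply: mulr0. Qed.

(** * Comparison of resolutions *)

Section GradedPart.

Variables (K : fieldType) (n : nat).
Local Notation S := {mpoly K[n]}.

Lemma homog_of_degreeP (z : int) (p : S) :
  homog_of_degree z p <-> (forall m, p@_m != 0 -> (mdeg m)%:Z = z).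
Proof.
case: z => k /=; split.
- by move=> /dhomogP hp m; rewrite -mcoeff_msupp => /hp ->.
- by move=> hp; apply/dhomogP => m; rewrite mcoeff_msupp => /hp [].
- by move=> -> m; rewrite mcoeff0 eqxx.
- move=> hp; apply/mpolyP => m; rewrite mcoeff0.
  by apply/eqP; apply: contraT => /hp.
Qed.

Definition graded_part (z : int) (p : S) : S :=
  \sum_(m <- msupp p | (mdeg m)%:Z == z) p@_m *: 'X_[m].

Lemma mcoeff_graded_part z p m :
  (graded_part z p)@_m = if (mdeg m)%:Z == z then p@_m else 0.
Proof.
rewrite raddf_sum /=.
under eq_bigr do rewrite mcoeffZ mcoeffX.
case: ifP => hm; last first.
  rewrite big1 // => i hi; case: eqP => [im|]; last by rewrite mulr0.
  by rewrite -im hi in hm.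
have [hp|hp] := boolP (m \in msupp p); last first.
  rewrite big1_seq => [|i /andP[_ hi]].
    by move: hp; rewrite mcoeff_msupp negbK => /eqP.
  by case: eqP hp hi => [<- /negP //|]; rewrite mulr0.
rewrite big_mkcond (bigD1_seq m) ?msupp_uniq //= hm eqxx mulr1.
by rewrite big1 ?addr0 // => i /negPf ->; rewrite mulr0 if_same.
Qed.

Lemma graded_part_homog z p : homog_of_degree z (graded_part z p).
Proof.
apply/homog_of_degreeP => m; rewrite mcoeff_graded_part.
by case: ifP => [/eqP //|_]; rewrite eqxx.
Qed.

Lemma graded_part_id z p : homog_of_degree z p -> graded_part z p = p.
Proof.
move/homog_of_degreeP => hp; apply/mpolyP => m; rewrite mcoeff_graded_part.
have [h|h] := eqVneq p@_m 0; first by rewrite h if_same.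
by rewrite (hp _ h) eqxx.
Qed.

Lemma graded_part_sum z (I : finType) (F : I -> S) :
  graded_part z (\sum_i F i) = \sum_i graded_part z (F i).
Proof.
apply/mpolyP => m; rewrite mcoeff_graded_part.
case: ifP => hm; rewrite !raddf_sum /=; last first.
  by rewrite big1 // => i _; rewrite mcoeff_graded_part hm.
by apply: eq_bigr => i _; rewrite mcoeff_graded_part hm.
Qed.

(** In the products of coefficients that contribute to a given monomial, the factor from [q]
    vanishes unless its degree is [z]; selecting total degree [y + z] thus selects degree [y] in
    [p]. *)
Lemma graded_partMr (y z : int) (p q : S) :
  homog_of_degree z q -> graded_part (y + z) (p * q) = graded_part y p * q.
Proof.
move=> /homog_of_degreeP hq; apply/mpolyP => m.
have key (m1 m2 : 'X_{1..n}) : m = (m1 + m2)%MM ->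
    (graded_part y p)@_m1 * q@_m2 =
    if (mdeg m)%:Z == y + z then p@_m1 * q@_m2 else 0.
  move=> ->; rewrite mcoeff_graded_part.
  have [h|h] := eqVneq q@_m2 0; first by rewrite h !mulr0 if_same.
  rewrite mdegD PoszD (hq _ h) (inj_eq (addIr _)).
  by case: ifP => _; rewrite ?mul0r.
rewrite mcoeff_graded_part !mcoeffM.
case: ifP key => hm key.
  by apply: eq_bigr => m12 /eqP /key ->.
by rewrite big1 // => m12 /eqP /key ->.
Qed.

End GradedPart.

(** * Lifting through resolutions, and the shifts of a minimal one *)

Section Comparison.

Variables (K : fieldType) (n : nat).
Local Notation S := {mpoly K[n]}.

Lemma mulmx_lift (R : pzRingType) (m k l : nat) (A : 'M[R]_(k, l))
    (B : 'M[R]_(m, l)) :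
  (forall i, exists v, row i B = v *m A) -> exists C, B = C *m A.
Proof.
move=> h; pose f i := proj1_sig (constructive_indefinite_description _ (h i)).
exists (\matrix_i f i); apply/row_matrixP => i; rewrite row_mul rowK /f.
by case: constructive_indefinite_description.
Qed.

(** The degree-preserving component of a map between graded free modules with shifts [u] and [v]. *)
Definition graded_mx (a b : nat) (u : 'I_a -> int) (v : 'I_b -> int)
    (A : 'M[S]_(a, b)) :=
  \matrix_(i, j) graded_part (u i - v j) (A i j).

Lemma graded_mxM (a b c : nat) (u : 'I_a -> int) (v : 'I_b -> int)
    (w : 'I_c -> int) (A : 'M[S]_(a, b)) (B : 'M[S]_(b, c)) :
  (forall i j, homog_of_degree (v i - w j) (B i j)) ->
  graded_mx u w (A *m B) = graded_mx u v A *m B.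
Proof.
move=> hB; apply/matrixP => i j; rewrite !mxE graded_part_sum.
apply: eq_bigr => k _; rewrite mxE -(graded_partMr _ _ (hB k j)).
by rewrite addrA subrK.
Qed.

Lemma graded_mxMl (a b c : nat) (u : 'I_a -> int) (v : 'I_b -> int)
    (w : 'I_c -> int) (A : 'M[S]_(a, b)) (B : 'M[S]_(b, c)) :
  (forall i j, homog_of_degree (u i - v j) (A i j)) ->
  (forall i j, homog_of_degree (v i - w j) (B i j)) ->
  graded_mx u w (A *m B) = A *m B.
Proof.
move=> hA hB; rewrite (graded_mxM _ _ hB); congr (_ *m _).
by apply/matrixP => i j; rewrite mxE graded_part_id.
Qed.

Lemma irrelevant_ideal0 (p : S) : irrelevant_ideal p -> p@_0%MM = 0.
Proof.
case=> k [c [g [hg ->]]]; rewrite raddf_sum big1 //= => i _.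
have [j ->] := hg i.
rewrite (mcoeff0_is_multiplicative n K).1 mcoeffX.
by rewrite mnm1_eq0 mulr0.
Qed.

Section Resolves.

Variables (F : free_complex K n) (I : S -> Prop).
Hypothesis hF : resolves F I.

Lemma resolves_lift0 (m : nat) (A : 'cV[S]_m) :
  (forall i, I (A i 0)) -> exists C, A = C *m aug F.
Proof.
case: hF => hI _ _ hA; apply: mulmx_lift => i.
have [v hv] := (hI _).1 (hA i); exists v; rewrite hv.
by apply/rowP => j; rewrite !mxE !ord1 eqxx mulr1n.
Qed.

Lemma resolves_lift1 (m : nat) (A : 'M[S]_(m, rk F 0)) :
  A *m aug F = 0 -> exists C, A = C *m diff F 0.
Proof.
case: hF => _ h _ hA; apply: mulmx_lift => i; apply/h.
by rewrite -row_mul hA row0.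
Qed.

Lemma resolves_lift (m i : nat) (A : 'M[S]_(m, rk F i.+1)) :
  A *m diff F i = 0 -> exists C, A = C *m diff F i.+1.
Proof.
case: hF => _ _ h hA; apply: mulmx_lift => k; apply/h.
by rewrite -row_mul hA row0.
Qed.

Lemma resolves_diff_aug : diff F 0 *m aug F = 0.
Proof.
case: hF => _ h _; apply/row_matrixP => i; rewrite row_mul row0.
by apply/h; exists (delta_mx 0 i); rewrite rowE.
Qed.

Lemma resolves_diff_diff i : diff F i.+1 *m diff F i = 0.
Proof.
case: hF => _ _ h; apply/row_matrixP => j; rewrite row_mul row0.
by apply/h; exists (delta_mx 0 j); rewrite rowE.
Qed.

Lemma resolves_aug j : I (aug F j 0).
Proof.
case: hF => h _ _; apply/h; exists (delta_mx 0 j); rewrite -rowE.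
by apply/rowP => k; rewrite !mxE !ord1 eqxx mulr1n.
Qed.

End Resolves.

(* [t] stands for [diff F i.-1 *m h'], where [h'] is the homotopy one degree
   below; recording only what the next step needs of it allows an induction
   without building the whole chain maps first. *)
Lemma resolves_homotopy (F G : free_complex K n) (I : S -> Prop) (i : nat) :
  graded F -> resolves F I -> minimal F -> graded G -> resolves G I ->
  exists (phi : 'M[S]_(rk F i, rk G i)) (psi : 'M[S]_(rk G i, rk F i))
         (h : 'M[S]_(rk F i, rk F i.+1)) (t : 'M[S]_(rk F i)),
    [/\ forall j k, homog_of_degree (sh j - sh k) (phi j k),
        phi *m psi = 1%:M + h *m diff F i + t,
        diff F i *m t = 0 & map_mx (mcoeff 0%MM) t = 0] /\
    (exists phi', diff F i *m phi = phi' *m diff G i) /\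
    (exists psi', diff G i *m psi = psi' *m diff F i).
Proof.
move=> gF rF mF gG rG.
elim: i => [|i [phi [psi [h [t [[hphi hpsi ht mt] [[phi' ephi] [psi'
  epsi]]]]]]]].
  have [phi0 e0] := resolves_lift0 rG (resolves_aug rF).
  have [psi e1] := resolves_lift0 rF (resolves_aug rG).
  (* The lift [phi0] need not be homogeneous; its degree-preserving component is again a lift, since
     both augmentations are homogeneous. *)
  pose phi := graded_mx (@sh _ _ F 0) (@sh _ _ G 0) phi0.
  have ephi : aug F = phi *m aug G.
    have hG j k : homog_of_degree (sh j - (fun=> 0) k) (aug G j k).
      by rewrite subr0 ord1; apply: gG.1.
    have hF j k : homog_of_degree (sh j - (fun=> 0) k) (aug F j k).
      by rewrite subr0 ord1; apply: gF.1.
    rewrite -(graded_mxM _ _ hG) -e0.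
    by apply/matrixP => j k; rewrite mxE graded_part_id.
  have /(resolves_lift1 rF) [h eh] : (phi *m psi - 1%:M) *m aug F = 0.
    by rewrite mulmxBl -mulmxA -e1 -ephi mul1mx subrr.
  exists phi, psi, h, 0; split; [split | split] => //.
  - by move=> j k; rewrite mxE; apply: graded_part_homog.
  - by rewrite -eh addr0 addrC subrK.
  - by rewrite mulmx0.
  - by rewrite map_mx0.
  - by apply: (resolves_lift1 rG); rewrite -mulmxA -ephi (resolves_diff_aug rF).
  - by apply: (resolves_lift1 rF); rewrite -mulmxA -e1 (resolves_diff_aug rG).
pose p := graded_mx (@sh _ _ F i.+1) (@sh _ _ G i.+1) phi'.
have ecomm : diff F i *m phi = p *m diff G i.
  by rewrite -(graded_mxM _ _ (gG.2 i)) -ephi (graded_mxMl (gF.2 i)).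
(* By the two commutation relations and the equation for [phi *m psi], this difference followed by
   [diff F i] is zero, so exactness gives [h']. The new error term is [diff F i *m h], whose
   constant coefficients vanish by minimality. *)
have [h' eh] : exists h',
    p *m psi' - 1%:M - diff F i *m h = h' *m diff F i.+1.
  apply: (resolves_lift rF).
  rewrite !mulmxBl mul1mx -mulmxA -epsi mulmxA -ecomm -mulmxA hpsi !mulmxDr.
  by rewrite mulmx1 ht addr0 mulmxA -addrA -opprD subrr.
exists p, psi', h', (diff F i *m h); split; [split | split].
- by move=> j k; rewrite mxE; apply: graded_part_homog.
- by rewrite -eh -addrA subrK addrC subrK.
- by rewrite mulmxA (resolves_diff_diff rF) mul0mx.
- rewrite map_mxM; suff -> : map_mx (mcoeff 0%MM) (diff F i) = 0.
    by rewrite mul0mx.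
  by apply/matrixP => j k; rewrite !mxE; apply/irrelevant_ideal0/mF.
- by apply: (resolves_lift rG); rewrite -mulmxA -ecomm mulmxA
    (resolves_diff_diff rF) mul0mx.
- by apply: (resolves_lift rF); rewrite -mulmxA -epsi mulmxA
    (resolves_diff_diff rG) mul0mx.
Qed.

(** Modulo the irrelevant ideal the differentials of [F] and the error term vanish, so [phi *m psi]
    becomes the identity. Row [j] of [phi] therefore has an entry with nonzero constant term; being
    homogeneous of degree [sh j - sh k], it forces equal shifts. *)
Lemma minimal_resolution_shift (F G : free_complex K n) (I : S -> Prop)
    (i : nat) (j : 'I_(rk F i)) :
  graded F -> resolves F I -> minimal F -> graded G -> resolves G I ->
  exists k : 'I_(rk G i), sh k = sh j.
Proof.
move=> gF rF mF gG rG.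
have [phi [psi [h [t [[hphi e _ mt] _]]]]] :=
  resolves_homotopy i gF rF mF gG rG.
have d0 : map_mx (mcoeff 0%MM) (diff F i) = 0.
  by apply/matrixP => a b; rewrite !mxE; apply/irrelevant_ideal0/mF.
have {e} : map_mx (mcoeff 0%MM) phi *m map_mx (mcoeff 0%MM) psi = 1%:M.
  by rewrite -map_mxM e !map_mxD mt map_mxM d0 mulmx0 !addr0 map_mx1.
move/matrixP/(_ j j); rewrite !mxE eqxx => e.
have [/existsP[k hk]|] := boolP [exists k, (phi j k)@_0%MM != 0].
  exists k; have /homog_of_degreeP /(_ _ hk) := hphi j k.
  by rewrite mdeg0 => /esym/eqP; rewrite subr_eq0 => /eqP.
rewrite negb_exists => /forallP h0; move: e; rewrite big1 => [/esym/eqP|k _].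
  by rewrite mulr1n oner_eq0.
by have := h0 k; rewrite negbK !mxE => /eqP ->; rewrite mul0r.
Qed.

End Comparison.

(** * Contractible multigraded complexes *)

Section Contractible.

Variables (K : fieldType) (n : nat).

(* A multigraded complex of free modules whose augmentation has the ideal of
   [monomial_span P] (below) as image.  The basis element [e] has homological
   degree [hdeg e] and multidegree [mndeg e]; the entry of the differential at
   [e], [e'] is [bd e e' * x^(mndeg e - mndeg e')], that of the augmentation is
   [eps e * x^(mndeg e)].  In each multidegree [a] with [P a], [htpy a] is a
   homotopy from the identity to [eps] followed by [1 |-> base a]; for other
   [a] these two are junk. *)
Record contractible (P : 'X_{1..n} -> bool) := Contractible {
  basis : finType;
  hdeg : basis -> nat;
  mndeg : basis -> 'X_{1..n};
  bd : basis -> basis -> K;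
  eps : basis -> K;
  htpy : 'X_{1..n} -> basis -> basis -> K;
  base : 'X_{1..n} -> basis -> K;
  pred_up : forall a b, P a -> (a <= b)%MM -> P b;
  pred_mndeg : forall e, P (mndeg e);
  bd_hdeg : forall e e', bd e e' != 0 -> hdeg e = (hdeg e').+1;
  bd_mndeg : forall e e', bd e e' != 0 -> (mndeg e' <= mndeg e)%MM;
  eps_hdeg : forall e, eps e != 0 -> hdeg e = 0%N;
  bd_bd : forall e e', \sum_x bd e x * bd x e' = 0;
  bd_eps : forall e, \sum_x bd e x * eps x = 0;
  base_hdeg : forall a e, base a e != 0 -> hdeg e = 0%N;
  base_mndeg : forall a e, P a -> base a e != 0 -> (mndeg e <= a)%MM;
  base_eps : forall a, P a -> \sum_e base a e * eps e = 1;
  htpy_hdeg : forall a e e', htpy a e e' != 0 -> hdeg e' = (hdeg e).+1;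
  htpy_mndeg : forall a e e', P a -> (mndeg e <= a)%MM -> htpy a e e' != 0 ->
    (mndeg e' <= a)%MM;
  htpyP : forall a e e', P a -> (mndeg e <= a)%MM ->
    \sum_x bd e x * htpy a x e' + \sum_x htpy a e x * bd x e' =
    (e == e')%:R - eps e * base a e'
}.

(** * Tensor product over the field, with lcm multidegrees *)

Section Product.

Variables (P Q : 'X_{1..n} -> bool) (C : contractible P) (D : contractible Q).
Local Notation E := (basis C * basis D)%type.
Local Notation sg e := ((-1) ^+ hdeg e).

Lemma sum_tensor (A A' : basis C -> K) (B B' : basis D -> K) :
  \sum_(z : E) (A z.1 * B z.2) * (A' z.1 * B' z.2) =
  (\sum_z A z * A' z) * (\sum_z B z * B' z).
Proof.
rewrite big_distrlr pair_bigA; apply: eq_bigr => -[a b] _ /=.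
by rewrite mulrACA.
Qed.

Lemma sum_tensorDl (A1 A2 A' : basis C -> K) (B1 B2 B' : basis D -> K) :
  \sum_(z : E) (A1 z.1 * B1 z.2 + A2 z.1 * B2 z.2) * (A' z.1 * B' z.2) =
  (\sum_z A1 z * A' z) * (\sum_z B1 z * B' z) +
  (\sum_z A2 z * A' z) * (\sum_z B2 z * B' z).
Proof.
by rewrite -!sum_tensor -big_split; apply: eq_bigr => z _; rewrite mulrDl.
Qed.

Lemma sum_tensorDlr (A1 A2 A1' A2' : basis C -> K)
    (B1 B2 B1' B2' : basis D -> K) :
  \sum_(z : E) (A1 z.1 * B1 z.2 + A2 z.1 * B2 z.2) *
               (A1' z.1 * B1' z.2 + A2' z.1 * B2' z.2) =
  (\sum_z A1 z * A1' z) * (\sum_z B1 z * B1' z) +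
  (\sum_z A2 z * A1' z) * (\sum_z B2 z * B1' z) +
  ((\sum_z A1 z * A2' z) * (\sum_z B1 z * B2' z) +
   (\sum_z A2 z * A2' z) * (\sum_z B2 z * B2' z)).
Proof.
by rewrite -!sum_tensorDl -big_split; apply: eq_bigr => z _; rewrite mulrDr.
Qed.

Definition prod_bd (x y : E) : K :=
  bd x.1 y.1 * (x.2 == y.2)%:R + (sg x.1 * (x.1 == y.1)%:R) * bd x.2 y.2.

Definition prod_eps (x : E) : K := eps x.1 * eps x.2.

Definition prod_base a (x : E) : K := base a x.1 * base a x.2.

(** The usual homotopy on a tensor product: contract the first factor, and contract the second one
    on the image of [eps] followed by [base]. The second term has no sign because [eps] lives in
    homological degree 0. *)
Definition prod_htpy a (x y : E) : K :=
  htpy a x.1 y.1 * (x.2 == y.2)%:R + (eps x.1 * base a y.1) * htpy a x.2 y.2.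

(** This and the next three lemmas handle the Koszul sign: it flips across maps changing the
    homological degree by one, and is trivial on [eps] and [base], which live in degree 0. *)
Lemma sg_bd (e e' : basis C) : bd e e' * sg e' = - (sg e * bd e e').
Proof.
have [->|/bd_hdeg ->] := eqVneq (bd e e') 0; first by rewrite mul0r mulr0 oppr0.
by rewrite exprS mulN1r mulNr opprK mulrC.
Qed.

Lemma sg_htpy a (e e' : basis C) : htpy a e e' * sg e' = - (sg e * htpy a e e').
Proof.
have [->|/htpy_hdeg ->] := eqVneq (htpy a e e') 0;
  first by rewrite mul0r mulr0 oppr0.
by rewrite exprS mulN1r mulrN mulrC.
Qed.

Lemma sg_eps (e : basis C) : sg e * eps e = eps e.
Proof. by have [->|/eps_hdeg ->] := eqVneq (eps e) 0;
  rewrite ?mulr0 ?mul1r. Qed.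

Lemma sg_base a (e : basis C) : base a e * sg e = base a e.
Proof. by have [->|/base_hdeg ->] := eqVneq (base a e) 0;
  rewrite ?mul0r ?mulr1. Qed.

Lemma base_bd a (e : basis C) : \sum_x base a x * bd x e = 0.
Proof.
apply: big1 => x _; have [->|/base_hdeg h] := eqVneq (base a x) 0;
  first exact: mul0r.
by have [->|/bd_hdeg] := eqVneq (bd x e) 0; rewrite ?mulr0 // h.
Qed.

Lemma prod_bd_bd x y : \sum_z prod_bd x z * prod_bd z y = 0.
Proof.
etransitivity.
  exact: (sum_tensorDlr (bd x.1) (fun z => sg x.1 * (x.1 == z)%:R)
    (fun z => bd z y.1) (fun z => sg z * (z == y.1)%:R)
    (fun z => (x.2 == z)%:R) (bd x.2)
    (fun z => (z == y.2)%:R) (fun z => bd z y.2)).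
rewrite !bd_bd mul0r add0r mulr0 addr0 !sum_sdeltal sum_sdeltar.
by rewrite sum_deltal sum_deltar sg_bd mulNr subrr.
Qed.

Lemma prod_bd_eps x : \sum_z prod_bd x z * prod_eps z = 0.
Proof.
etransitivity.
  exact: (sum_tensorDl (bd x.1) (fun z => sg x.1 * (x.1 == z)%:R) (@eps _ C)
    (fun z => (x.2 == z)%:R) (bd x.2) (@eps _ D)).
by rewrite !bd_eps mul0r mulr0 addr0.
Qed.

(** Write [p] for [eps] followed by [base]. The mixed terms, [htpy] tensor [bd], occur in the two
    sums with opposite signs and cancel; what remains is [(1 - p)] tensor [1] plus [p] tensor
    [(1 - p)], which telescopes to [1] minus [p] tensor [p]. *)
Lemma prod_homotopy a x y :
  P a -> Q a -> (mndeg x.1 <= a)%MM -> (mndeg x.2 <= a)%MM ->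
  \sum_z prod_bd x z * prod_htpy a z y + \sum_z prod_htpy a x z * prod_bd z y =
  (x == y)%:R - prod_eps x * prod_base a y.
Proof.
move=> Pa Qa hx1 hx2.
have -> : \sum_z prod_bd x z * prod_htpy a z y =
    (\sum_z bd x.1 z * htpy a z y.1) * (x.2 == y.2)%:R +
    (sg x.1 * htpy a x.1 y.1) * bd x.2 y.2 +
    (eps x.1 * base a y.1) * (\sum_z bd x.2 z * htpy a z y.2).
  etransitivity.
    exact: (sum_tensorDlr (bd x.1) (fun z => sg x.1 * (x.1 == z)%:R)
      (fun z => htpy a z y.1) (fun z => eps z * base a y.1)
      (fun z => (x.2 == z)%:R) (bd x.2)
      (fun z => (z == y.2)%:R) (fun z => htpy a z y.2)).
  rewrite !sum_sdeltal !sum_deltal sum_deltar.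
  under [\sum_z bd x.1 z * (eps z * base a y.1)]eq_bigr do rewrite mulrA.
  by rewrite -mulr_suml bd_eps mul0r mul0r add0r [sg _ * (_ * _)]mulrA sg_eps.
have -> : \sum_z prod_htpy a x z * prod_bd z y =
    (\sum_z htpy a x.1 z * bd z y.1) * (x.2 == y.2)%:R -
    (sg x.1 * htpy a x.1 y.1) * bd x.2 y.2 +
    (eps x.1 * base a y.1) * (\sum_z htpy a x.2 z * bd z y.2).
  etransitivity.
    exact: (sum_tensorDlr (htpy a x.1) (fun z => eps x.1 * base a z)
      (fun z => bd z y.1) (fun z => sg z * (z == y.1)%:R)
      (fun z => (x.2 == z)%:R) (htpy a x.2)
      (fun z => (z == y.2)%:R) (fun z => bd z y.2)).
  rewrite !sum_sdeltar !sum_deltal sum_deltar.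
  under [\sum_z (eps x.1 * base a z) * bd z y.1]eq_bigr do rewrite -mulrA.
  rewrite -mulr_sumr base_bd mulr0 mul0r addr0 sg_htpy mulNr -[_ * _ * sg
    y.1]mulrA.
  by rewrite sg_base addrA.
have h1 := htpyP y.1 Pa hx1; have h2 := htpyP y.2 Qa hx2.
rewrite addrACA [X in X + _]addrACA -mulrDl h1 -mulrDr h2 subrr addr0.
rewrite mulrBl mulrBr addrA subrK -natrM mulnb.
by rewrite /prod_eps /prod_base mulrACA; case: x y {hx1 hx2 h1 h2} => ? ? [? ?].
Qed.

Lemma prod_bd_neq0 x y : prod_bd x y != 0 ->
  bd x.1 y.1 != 0 /\ x.2 = y.2 \/ x.1 = y.1 /\ bd x.2 y.2 != 0.
Proof.
rewrite /prod_bd; have [->|h1] := eqVneq x.1 y.1.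
  have [->|h2 _] := eqVneq (bd x.2 y.2) 0; last by right.
  rewrite mulr0 addr0 mulf_eq0 negb_or => /andP[h].
  by have [->|] := eqVneq x.2 y.2; [left|rewrite eqxx].
rewrite mulr0 mul0r addr0 mulf_eq0 negb_or => /andP[h].
by have [->|] := eqVneq x.2 y.2; [left|rewrite eqxx].
Qed.

Lemma prod_htpy_neq0 a x y : prod_htpy a x y != 0 ->
  htpy a x.1 y.1 != 0 /\ x.2 = y.2 \/
  [/\ eps x.1 != 0, base a y.1 != 0 & htpy a x.2 y.2 != 0].
Proof.
rewrite /prod_htpy; have [h0|h0] := eqVneq (eps x.1 * base a y.1 * htpy a x.2
  y.2) 0.
  rewrite h0 addr0 mulf_eq0 negb_or => /andP[h].
  by have [->|] := eqVneq x.2 y.2; [left|rewrite eqxx].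
by move: h0; rewrite !mulf_eq0 !negb_or => /andP[/andP[]] *; right.
Qed.

(** An lcm divides [x^a] exactly when both of its arguments do, so every divisibility condition
    splits into one for each factor. *)
Definition prod_contractible : contractible (fun a => P a && Q a).
Proof.
refine (@Contractible _ E (fun x => hdeg x.1 + hdeg x.2)%N
  (fun x => mlcm (mndeg x.1) (mndeg x.2)) prod_bd prod_eps prod_htpy prod_base
  _ _ _ _ _ prod_bd_bd prod_bd_eps _ _ _ _ _ _).
- by move=> a b /andP[/(pred_up C) h1 /(pred_up D) h2] ab; rewrite h1 ?h2.
- move=> e; rewrite (pred_up C (pred_mndeg e.1)) ?lem_mlcml //.
  by rewrite (pred_up D (pred_mndeg e.2)) ?lem_mlcmr.
- by move=> x y /prod_bd_neq0[[/bd_hdeg -> ->]|[-> /bd_hdeg ->]];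
    rewrite ?addSn ?addnS.
- move=> x y /prod_bd_neq0 h; rewrite lem_mlcm.
  case: h => [[/bd_mndeg h ->]|[-> /bd_mndeg h]];
    rewrite ?lem_mlcml ?lem_mlcmr ?andbT /=.
    exact: lepm_trans h (lem_mlcml _ _).
  exact: lepm_trans h (lem_mlcmr _ _).
- by move=> x; rewrite mulf_eq0 negb_or => /andP[/eps_hdeg -> /eps_hdeg ->].
- by move=> a x; rewrite mulf_eq0 negb_or => /andP[/base_hdeg -> /base_hdeg ->].
- move=> a x /andP[Pa Qa]; rewrite mulf_eq0 negb_or lem_mlcm.
  by case/andP=> h1 h2; rewrite (base_mndeg Pa h1) (base_mndeg Qa h2).
- move=> a /andP[Pa Qa].
  etransitivity; first exact: (sum_tensor (base a) (@eps _ C) (base a) (@eps _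
    D)).
  by rewrite !base_eps ?mulr1.
- move=> a x y /prod_htpy_neq0 [[/htpy_hdeg -> ->]|[/eps_hdeg ->
    /base_hdeg -> /htpy_hdeg ->]].
    by rewrite addSn.
  by rewrite addnS.
- move=> a x y /andP[Pa Qa]; rewrite !lem_mlcm => /andP[h1 h2].
  case/prod_htpy_neq0=> [[h <-]|[_ h h']];
    first by rewrite (htpy_mndeg Pa h1 h).
  by rewrite (base_mndeg Pa h) (htpy_mndeg Qa h2 h').
- move=> a x y /andP[Pa Qa]; rewrite lem_mlcm => /andP[h1 h2].
  exact: prod_homotopy.
Defined.

End Product.

(* Adding a generator [f]: [inl e] are the old basis elements, [inr None] is the
   new generator, and [inr (Some e)] joins [e] to it. *)
Section Cone.

Variables (P : 'X_{1..n} -> bool) (C : contractible P) (f : 'X_{1..n}).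
Local Notation B := (basis C).
Local Notation E := (B + option B)%type.

Lemma sum_cone (F : E -> K) :
  \sum_x F x = \sum_x F (inl x) + F (inr None) + \sum_x F (inr (Some x)).
Proof.
rewrite big_sumType -addrA /=; congr (_ + _).
rewrite (bigD1 None) //=; congr (_ + _).
rewrite (reindex_omap Some id) //=; last by case.
by apply: eq_bigl => x; rewrite eqxx.
Qed.

Definition cone_hdeg (x : E) : nat :=
  match x with inl e => hdeg e | inr None => 0 | inr (Some e) =>
    (hdeg e).+1 end.

Definition cone_mndeg (x : E) :=
  match x with inl e => mndeg e | inr None => f | inr (Some e) =>
    mlcm (mndeg e) f end.

(** A mapping cone: the [inr] part is the augmented complex of [C], shifted by one in homological
    degree and hence with negated differential, and it maps to [C] by the identity on the [Some]
    elements. *)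
Definition cone_bd (x y : E) : K :=
  match x, y with
  | inl e, inl e' => bd e e'
  | inr (Some e), inl e' => (e == e')%:R
  | inr (Some e), inr None => - eps e
  | inr (Some e), inr (Some e') => - bd e e'
  | _, _ => 0
  end.

Definition cone_eps (x : E) : K :=
  match x with inl e => eps e | inr None => 1 | inr (Some e) => 0 end.

Definition cone_base a (y : E) : K :=
  if (f <= a)%MM then (y == inr None)%:R else
  if y is inl e then base a e else 0.

(** If [f] divides [x^a], then joining [f] to an old element stays within multidegree [a], and
    pairing each [e] with its join contracts everything onto [f], whether or not [P a] holds.
    Otherwise only old elements divide [x^a], and the homotopy of [C] applies. *)
Definition cone_htpy a (x y : E) : K :=
  match x, y with
  | inl e, inr (Some e') => if (f <= a)%MM then (e == e')%:R else 0
  | inl e, inl e' => if (f <= a)%MM then 0 else htpy a e e'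
  | _, _ => 0
  end.

Lemma cone_bd_bd x y : \sum_z cone_bd x z * cone_bd z y = 0.
Proof.
rewrite sum_cone; case: x => [e|[e|]] /=.
- rewrite mul0r addr0 [X in _ + X]big1 ?addr0 => [|? _]; last exact: mul0r.
  by case: y => [e'|[e'|]]; rewrite ?bd_bd // big1 // => ? _; rewrite mulr0.
- rewrite mulr0 addr0 sum_deltal.
  under eq_bigr do rewrite mulNr.
  rewrite sumrN; case: y => [e'|[e'|]]; rewrite ?sum_deltar ?subrr //=.
    by under eq_bigr do rewrite mulrN; rewrite sumrN bd_bd !oppr0 addr0.
  by under eq_bigr do rewrite mulrN; rewrite sumrN bd_eps !oppr0 addr0.
- by rewrite mul0r addr0 !big1 ?addr0 // => ? _; rewrite mul0r.
Qed.

Lemma cone_bd_eps x : \sum_z cone_bd x z * cone_eps z = 0.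
Proof.
rewrite sum_cone; case: x => [e|[e|]] /=.
- by rewrite bd_eps mul0r !add0r big1 // => ? _; rewrite mul0r.
- rewrite sum_deltal mulr1 subrr add0r big1 // => ? _; exact: mulr0.
- by rewrite !big1 ?mul0r ?addr0 // => ? _; rewrite mul0r.
Qed.

Lemma cone_base_eps a :
  P a || (f <= a)%MM -> \sum_e cone_base a e * cone_eps e = 1.
Proof.
rewrite sum_cone /cone_base /=; case: ifP => h; rewrite ?orbF => Pa.
  rewrite !mulr1 !big1 ?add0r ?addr0 // => ? _; exact: mul0r.
by rewrite base_eps // !mul0r big1 ?addr0 // => ? _; rewrite mul0r.
Qed.

Lemma cone_homotopy a x y : P a || (f <= a)%MM -> (cone_mndeg x <= a)%MM ->
  \sum_z cone_bd x z * cone_htpy a z y + \sum_z cone_htpy a x z * cone_bd z y =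
  (x == y)%:R - cone_eps x * cone_base a y.
Proof.
rewrite !sum_cone /cone_base => Pa hx.
have z0 := (mul0r, mulr0, sum_mul0r, sum_mulr0, big1_eq, addr0, add0r, oppr0).
have [fa|fa] := boolP (f <= a)%MM; last first.
  rewrite (negPf fa) orbF in Pa *.
  case: x hx => [e|[e|]] /= hx; last by rewrite hx in fa.
  - rewrite (negPf fa) !z0; case: y => [e'|[e'|]]; rewrite /= ?z0 //.
    exact: htpyP.
  - by move: hx fa; rewrite lem_mlcm => /andP[_ ->].
case: x hx => [e|[e|]] /= hx; rewrite fa ?z0.
- case: y => [e'|[e'|]]; rewrite /= ?z0 ?sum_deltal ?sum_deltar ?subrr //.
  by rewrite mulr1.
- by case: y => [e'|[e'|]]; rewrite /= ?z0 ?sum_deltal.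
- by case: y => [e'|[e'|]]; rewrite /= ?z0 ?mulr1 ?subrr.
Qed.

Definition cone_contractible : contractible (fun a => P a || (f <= a)%MM).
Proof.
refine (@Contractible _ E cone_hdeg cone_mndeg cone_bd cone_eps cone_htpy
  cone_base
  _ _ _ _ _ cone_bd_bd cone_bd_eps _ _ cone_base_eps _ _ cone_homotopy).
- move=> a b /orP[/(pred_up C) h /h ->//|h1 h2].
  by rewrite (lepm_trans h1 h2) orbT.
- by case=> [e|[e|]] /=; rewrite ?pred_mndeg ?lem_mlcmr ?lepm_refl ?orbT.
- case=> [e|[e|]] [e'|[e'|]] /=; rewrite ?eqxx // ?oppr_eq0.
  + exact: bd_hdeg.
  + by case: (eqVneq e e') => [->|]; rewrite ?eqxx.
  + by move/bd_hdeg ->.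
  + by move/eps_hdeg ->.
- case=> [e|[e|]] [e'|[e'|]] /=; rewrite ?eqxx // ?oppr_eq0.
  + exact: bd_mndeg.
  + by case: (eqVneq e e') => [->|]; rewrite ?eqxx // lem_mlcml.
  + by move/bd_mndeg => h; rewrite lem_mlcm lem_mlcmr andbT (lepm_trans h)
      ?lem_mlcml.
  + by rewrite lem_mlcmr.
- by case=> [e|[e|]] //=; rewrite ?eqxx //; apply: eps_hdeg.
- move=> a [e|[e|]]; rewrite /cone_base /=; case: ifP; rewrite ?eqxx // => _.
  exact: base_hdeg.
- move=> a [e|[e|]]; rewrite /cone_base /=; case: ifP;
    rewrite ?orbF ?eqxx // => _.
  exact: base_mndeg.
- move=> a [e|[e|]] [e'|[e'|]]; rewrite /cone_htpy /= ?eqxx //; case: ifP;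
    rewrite ?eqxx //.
    by move=> _; apply: htpy_hdeg.
  by case: (eqVneq e e') => [->|]; rewrite ?eqxx.
- move=> a [e|[e|]] [e'|[e'|]]; rewrite /cone_htpy /= ?eqxx //; case: ifP;
    rewrite ?eqxx ?orbF //.
    by move=> _; apply: htpy_mndeg.
  by move=> fa _ h; rewrite lem_mlcm fa andbT; case: (eqVneq e e') => [<-|];
    rewrite ?eqxx.
Defined.

End Cone.

Definition void_contractible : contractible (fun=> false).
Proof.
by refine (@Contractible _ void (fun=> 0%N) (fun=> 0%MM) (fun _ _ =>
  0) (fun=> 0)
  (fun _ _ _ => 0) (fun _ _ => 0) _ _ _ _ _ _ _ _ _ _ _ _ _) => // -[].
Defined.

(** Serves both the complete intersection generated by 1 and the empty intersection. *)
Definition unit_contractible : contractible (fun=> true).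
Proof.
refine (@Contractible _ unit (fun=> 0%N) (fun=> 0%MM) (fun _ _ => 0) (fun=> 1)
  (fun _ _ _ => 0) (fun _ _ => 1) _ _ _ _ _ _ _ _ _ _ _ _ _); rewrite //=.
- by move=> _ _; rewrite eqxx.
- by move=> _ _; rewrite eqxx.
- by move=> _ _; apply: sum_mul0r.
- by move=> _; apply: sum_mul0r.
- by move=> a _ _ _; apply/mnm_lepP => i; rewrite mnm0E.
- by move=> a _; rewrite (big_pred1 tt) ?mulr1 //; case.
- by move=> a _ _; rewrite eqxx.
- by move=> a _ _ _ _; rewrite !sum_mul0r mulr1 subrr addr0.
Defined.

End Contractible.

(** * Homogenization *)

Section Homogenization.

Variables (K : fieldType) (n : nat) (P : 'X_{1..n} -> bool).
Variable C : contractible K P.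
Local Notation S := {mpoly K[n]}.

Definition monomial_span (p : S) : Prop := forall m, m \in msupp p -> P m.

Definition level i := [pred e : basis C | hdeg e == i].

(** The monomial entries restore multihomogeneity. The truncated subtraction of exponents is exact
    wherever [bd] is nonzero, by [bd_mndeg]. *)
Definition homogenization : free_complex K n := {|
  rk := fun i => #|level i|;
  sh := fun i j => (mdeg (mndeg (enum_val j)))%:Z;
  Defs.diff := fun i => \matrix_(j, k)
    (bd (enum_val j) (enum_val k) *: 'X_[mndeg (enum_val j) - mndeg (enum_val
      k)]);
  aug := \col_j (eps (enum_val j) *: 'X_[mndeg (enum_val j)])
|}.
Local Notation F := homogenization.
Local Notation ev := (@enum_val (basis C) (mem (level _))).

Lemma level_hdeg i (j : 'I_(rk F i)) : hdeg (ev j) = i.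
Proof. by apply/eqP; have := enum_valP j. Qed.

Lemma level_ev i (e : basis C) : hdeg e = i -> exists j : 'I_(rk F i), e = ev j.
Proof.
move=> h; have he : e \in level i by rewrite inE h.
by exists (enum_rank_in he e); rewrite enum_rankK_in.
Qed.

(* The coefficients of [v] in multidegree [a]. *)
Definition strand i (v : 'rV[S]_(rk F i)) (a : 'X_{1..n}) (e : basis C) : K :=
  \sum_(j | ev j == e) if (mndeg e <= a)%MM then (v 0 j)@_(a - mndeg e) else 0.

Lemma strand_ev i (v : 'rV[S]_(rk F i)) a (j : 'I_(rk F i)) :
  strand v a (ev j) =
  if (mndeg (ev j) <= a)%MM then (v 0 j)@_(a - mndeg (ev j)) else 0.
Proof. by rewrite /strand (big_pred1 j) // => k;
  rewrite (inj_eq enum_val_inj). Qed.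

Lemma strand_hdeg i (v : 'rV[S]_(rk F i)) a e : strand v a e != 0 -> hdeg e = i.
Proof.
apply: contra_neq_eq => /eqP h; rewrite /strand big_pred0 // => j.
by apply/eqP => he; case: h; rewrite -he level_hdeg.
Qed.

Lemma strand_mndeg i (v : 'rV[S]_(rk F i)) a e :
  strand v a e != 0 -> (mndeg e <= a)%MM.
Proof.
by apply: contra_neqT => /negPf h; rewrite /strand big1 // => j _; rewrite h.
Qed.

Lemma eq_strand i (v w : 'rV[S]_(rk F i)) :
  (forall a e, strand v a e = strand w a e) -> v = w.
Proof.
move=> h; apply/rowP => j; apply/mpolyP => c.
by have := h (c + mndeg (ev j))%MM (ev j); rewrite !strand_ev lem_addl addmK.
Qed.

Lemma sum_strand i (v : 'rV[S]_(rk F i)) a (g : basis C -> K) :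
  \sum_e strand v a e * g e = \sum_(j < rk F i) strand v a (ev j) * g (ev j).
Proof.
rewrite -(big_enum_val (A := level i) (fun e => strand v a e * g e)).
rewrite [LHS](bigID (mem (level i))) /= [X in _ + X]big1 ?addr0 // => e he.
have [->|/strand_hdeg h] := eqVneq (strand v a e) 0; first exact: mul0r.
by rewrite inE h eqxx in he.
Qed.

(** Multiplying by a monomial entry only shifts exponents within a fixed multidegree, so there the
    homogenized differential acts as the scalar matrix [bd]. *)
Lemma strand_mul i (v : 'rV[S]_(rk F i.+1)) a e :
  strand (v *m diff F i) a e = \sum_x strand v a x * bd x e.
Proof.
have [he|he] := eqVneq (hdeg e) i; last first.
  have [->|/strand_hdeg h] := eqVneq (strand (v *m diff F i) a e) 0; last first.
    by rewrite h eqxx in he.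
  rewrite big1 // => x _; have [->|/strand_hdeg h] := eqVneq (strand v a x) 0.
    exact: mul0r.
  have [->|/bd_hdeg] := eqVneq (bd x e) 0; first exact: mulr0.
  by rewrite h => -[/esym/eqP]; rewrite (negPf he).
have [k ->] := level_ev he; rewrite sum_strand strand_ev mxE raddf_sum /=.
under eq_bigr do rewrite mxE -scalerAr mcoeffZ mcoeffMX_if.
under [RHS]eq_bigr do rewrite strand_ev.
case: ifP => ha; last first.
  rewrite big1 // => j _; have [->|/bd_mndeg h] := eqVneq (bd (ev j) (ev k)) 0.
    exact: mulr0.
  by case: ifP => h'; [rewrite (lepm_trans h h') in ha|rewrite mul0r].
apply: eq_bigr => j _; rewrite mulrC.
have [->|/bd_mndeg h] := eqVneq (bd (ev j) (ev k)) 0; first by rewrite !mulr0.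
congr (_ * _).
have -> : (mndeg (ev j) - mndeg (ev k) <= a - mndeg (ev k))%MM = (mndeg (ev j)
  <= a)%MM.
  by apply: eq_forallb => x; rewrite !mnmBE leq_sub2rE ?(mnm_lepP ha).
case: ifP => // h'; congr (_ @_ _); apply/mnmP => x.
by rewrite !mnmBE subnBA ?subnK ?(mnm_lepP ha) ?(mnm_lepP h).
Qed.

Lemma mcoeff_mul_aug (v : 'rV[S]_(rk F 0)) a :
  ((v *m aug F) 0 0)@_a = \sum_x strand v a x * eps x.
Proof.
rewrite sum_strand mxE raddf_sum /=; apply: eq_bigr => j _.
by rewrite mxE -scalerAr mcoeffZ mcoeffMX_if strand_ev mulrC.
Qed.

Lemma strand_bounded i (v : 'rV[S]_(rk F i)) :
  exists N, forall a e, strand v a e != 0 -> (mdeg a < N)%N.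
Proof.
exists (\max_(j < rk F i) (msize (v 0%R j) + mdeg (mndeg (ev j))))%N => a e h.
have [j ej] := level_ev (strand_hdeg h); have ha := strand_mndeg h.
move: h; rewrite ej strand_ev -ej ha -mcoeff_msupp => /msize_mdeg_lt h.
apply: leq_trans (leq_bigmax j).
by rewrite -(submK ha) mdegD ej ltn_add2r -ej.
Qed.

(** Allows elements to be built one multidegree at a time; the bound [N] makes each component a
    polynomial. *)
Lemma strand_exists i N (u : 'X_{1..n} -> basis C -> K) :
  (forall a e, u a e != 0 ->
    [/\ hdeg e = i, (mndeg e <= a)%MM & (mdeg a < N)%N]) ->
  exists v : 'rV[S]_(rk F i), forall a e, strand v a e = u a e.
Proof.
move=> hu.
exists (\row_j \sum_(c : 'X_{1..n < N}) u (c + mndeg (ev j))%MM (ev j) *: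
  'X_[c]).
move=> a e; have [he|he] := eqVneq (hdeg e) i; last first.
  have [->|/hu[h]] := eqVneq (u a e) 0; last by rewrite h eqxx in he.
  by apply/eqP; apply: contraNT he => /strand_hdeg ->.
have [j ->] := level_ev he; rewrite strand_ev mxE.
case: ifP => ha; last first.
  by apply/esym/eqP; apply: contraFT ha => /hu[].
pose g c := u (c + mndeg (ev j))%MM (ev j).
have [hN|hN] := ltnP (mdeg (a - mndeg (ev j))%MM) N.
  by rewrite (mcoeff_mpoly g hN) /g submK.
have -> : u a (ev j) = 0.
  apply/eqP; apply: contraTT hN => /hu[_ _ h]; rewrite -ltnNge.
  by apply: leq_ltn_trans h; rewrite -{2}(submK ha) mdegD leq_addr.
rewrite raddf_sum big1 // => c _ /=; rewrite mcoeffZ mcoeffX.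
case: eqP => [h|]; last by rewrite mulr0.
by have := bmdeg c; rewrite h ltnNge hN.
Qed.

(* [v = (v s) d] whenever [v d = 0] and [v] has no augmentation, where [s] is
   the contraction in the relevant multidegree. *)
Lemma strand_exact i (v : 'rV[S]_(rk F i)) :
  (forall a e, \sum_x strand v a x * bd x e = 0) ->
  (forall a, \sum_x strand v a x * eps x = 0) ->
  exists w : 'rV[S]_(rk F i.+1), v = w *m diff F i.
Proof.
move=> hd0 he0; have [N hN] := strand_bounded v.
(* Wherever [v] has a nonzero coefficient, [htpy] is a true homotopy and not junk. *)
have hP a e : strand v a e != 0 -> P a.
  by move/strand_mndeg; apply: (pred_up C); apply: pred_mndeg.
(* The contraction preserves multidegrees, so the bound for [v] serves for [w] too. *)
have [a e|w hw] := strand_exists (i := i.+1) (N := N)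
    (u := fun a e => \sum_x strand v a x * htpy a x e).
  have [/existsP[x]|] := boolP [exists x, strand v a x * htpy a x e != 0].
    rewrite mulf_eq0 negb_or => /andP[h1 h2] _.
    rewrite (htpy_hdeg h2) (strand_hdeg h1) (hN _ _ h1); split=> //.
    exact: htpy_mndeg (hP _ _ h1) (strand_mndeg h1) h2.
  rewrite negb_exists => /forallP h; rewrite big1 ?eqxx // => x _.
  by have := h x; rewrite negbK => /eqP.
exists w; apply: eq_strand => a e; rewrite strand_mul.
under eq_bigr do rewrite hw big_distrl.
rewrite exchange_big /=.
(* The added [eps] term vanishes by [he0]; it turns the identity into the right side of [htpyP]. *)
transitivity (\sum_x strand v a x * ((x == e)%:R - eps x * base a e)).
  under eq_bigr do rewrite mulrBr mulrA.
  by rewrite sumrB sum_deltar -mulr_suml he0 mul0r subr0.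
transitivity (\sum_x strand v a x *
   (\sum_y bd x y * htpy a y e + \sum_y htpy a x y * bd y e)).
  apply: eq_bigr => x _; have [->|h] := eqVneq (strand v a x) 0.
    by rewrite !mul0r.
  by rewrite htpyP ?(hP _ _ h) ?(strand_mndeg h).
under [LHS]eq_bigr do rewrite mulrDr !big_distrr /=.
rewrite big_split /= [X in X + _]exchange_big /=.
rewrite [X in X + _]big1 ?add0r => [|y _].
  by apply: eq_bigr => x _; apply: eq_bigr => y _; rewrite mulrA.
by under eq_bigr do rewrite mulrA; rewrite -mulr_suml hd0 mul0r.
Qed.

Lemma strand0 i a e : strand (0 : 'rV[S]_(rk F i)) a e = 0.
Proof. by rewrite /strand big1 // => j _; rewrite mxE mcoeff0 if_same. Qed.

Lemma homogenization_graded : graded F.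
Proof.
split=> [j|i j k]; apply/homog_of_degreeP => m; rewrite mxE mcoeffZ mcoeffX.
  by case: (_ =P m) => [<-|]; rewrite ?mulr0 ?eqxx.
case: (_ =P m) => [<-|]; rewrite ?mulr0 ?eqxx // mulr1 => /bd_mndeg h.
by rewrite /= -{2}(submK h) mdegD PoszD addrK.
Qed.

Lemma homogenization_finite_length : finite_length F.
Proof.
exists (\max_(e : basis C) hdeg e)%N => i hi; apply: eq_card0 => e.
rewrite inE; apply: contraTF hi => /eqP <-; rewrite -leqNgt.
exact: (leq_bigmax (F := @hdeg _ _ _ C) e).
Qed.

Lemma homogenization_resolves : resolves F monomial_span.
Proof.
split.
- move=> p; split.
    (* A preimage of [p]: each coefficient of [p] times the [base] of its multidegree, which [eps]
       sends to 1. *)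
    move=> hp; have [a e|v hv] := strand_exists (i := 0) (N := msize p)
        (u := fun a e => p@_a * base a e).
      rewrite mulf_eq0 negb_or -mcoeff_msupp => /andP[h1 h2].
      rewrite (base_hdeg h2) (msize_mdeg_lt h1); split=> //.
      exact: base_mndeg (hp _ h1) h2.
    exists v; apply/matrixP => i j; rewrite !ord1 !mxE eqxx mulr1n.
    apply/mpolyP => a; have := mcoeff_mul_aug v a; rewrite mxE => ->.
    under eq_bigr do rewrite hv -mulrA.
    rewrite -mulr_sumr; have [->|h] := eqVneq p@_a 0; first by rewrite mul0r.
    by rewrite base_eps ?mulr1 //; apply: hp; rewrite mcoeff_msupp.
  case=> v hv a; rewrite mcoeff_msupp.
  have -> : p = (v *m aug F) 0 0 by rewrite hv mxE eqxx mulr1n.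
  rewrite mcoeff_mul_aug => h.
  have [/existsP[x]|] := boolP [exists x, strand v a x * eps x != 0].
    rewrite mulf_eq0 negb_or => /andP[/strand_mndeg hx _].
    exact: (pred_up C (pred_mndeg x) hx).
  rewrite negb_exists => /forallP h'; move: h; rewrite big1 ?eqxx // => x _.
  by have := h' x; rewrite negbK => /eqP.
- move=> v; split=> [h|[w ->]].
    (* In homological degree 0 the condition on [bd] is automatic. *)
    apply: strand_exact => [a e|a]; last by rewrite -mcoeff_mul_aug h mxE
      mcoeff0.
    apply: big1 => x _; have [->|/strand_hdeg h'] := eqVneq (strand v a x) 0.
      exact: mul0r.
    by have [->|/bd_hdeg] := eqVneq (bd x e) 0; rewrite ?mulr0 // h'.
  apply/rowP => j; rewrite !ord1 [RHS]mxE; apply/mpolyP => a.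
  rewrite mcoeff_mul_aug mcoeff0; under eq_bigr do rewrite strand_mul
    big_distrl.
  rewrite exchange_big big1 //= => x _.
  by under eq_bigr do rewrite -mulrA; rewrite -mulr_sumr bd_eps mulr0.
- move=> i v; split=> [h|[w ->]].
    (* In positive homological degree it is the condition on [eps] that is automatic. *)
    apply: strand_exact => [a e|a]; first by rewrite -strand_mul h strand0.
    apply: big1 => x _; have [->|/strand_hdeg h'] := eqVneq (strand v a x) 0.
      exact: mul0r.
    by have [->|/eps_hdeg] := eqVneq (eps x) 0; rewrite ?mulr0 // h'.
  apply: eq_strand => a e; rewrite strand0 strand_mul.
  under eq_bigr do rewrite strand_mul big_distrl.
  rewrite exchange_big big1 //= => x _.
  by under eq_bigr do rewrite -mulrA; rewrite -mulr_sumr bd_bd mulr0.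
Qed.

(** A nonzero entry is a scalar times a monomial different from 1, hence divisible by a variable. *)
Lemma homogenization_minimal :
  (forall e e' : basis C, bd e e' != 0 -> mndeg e' != mndeg e) -> minimal F.
Proof.
move=> hC i j k; rewrite mxE; move: (hC (ev j) (ev k)) (@bd_mndeg _ _ _ _ (ev
  j) (ev k)).
case: eqP => [-> _ _|_ /(_ isT) h /(_ isT) h'].
  by rewrite scale0r; exists 0, (fun=> 0), (fun=> 0); split=> [[]//|];
    rewrite big_ord0.
have /mnm_neq0P[x hx] : (mndeg (ev j) - mndeg (ev k))%MM != 0%MM.
  by apply: contraNneq h => h0; rewrite -(submK h') h0 add0m.
exists 1%N, (fun=> bd (ev j) (ev k) *: 'X_[mndeg (ev j) - mndeg (ev k) -
  U_(x)]).
exists (fun=> 'X_x); split; first by move=> _; exists x.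
by rewrite big_ord1 -scalerAl -mpolyXD submK // lep1mP.
Qed.

End Homogenization.

(** * Monomial complete intersections *)

Section MonomialIdeals.

Variables (K : fieldType) (n : nat).
Local Notation S := {mpoly K[n]}.

Definition generated_by (s : seq 'X_{1..n}) (a : 'X_{1..n}) : bool :=
  has (fun g => (g <= a)%MM) s.

Lemma ideal_seq_monomials (s : seq 'X_{1..n}) (p : S) :
  ideal_seq (monomials K s) p <-> monomial_span (generated_by s) p.
Proof.
split.
  case=> k [c [g [hg ->]]] m; rewrite mcoeff_msupp raddf_sum /= => h.
  have [/existsP[i]|] := boolP [exists i, (c i * g i)@_m != 0].
    have /mapP[f fs ->] := hg i; rewrite mcoeffMX_if.
    by case: ifP => [fm _|]; [apply/hasP; exists f|rewrite eqxx].
  rewrite negb_exists => /forallP h'; move: h; rewrite big1 ?eqxx // => i _.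
  by have := h' i; rewrite negbK => /eqP.
move=> hp; pose m i := nth 0%MM (msupp p) i.
(* To each monomial of [p] is assigned the first generator dividing it. *)
pose f i := nth 0%MM s (find (fun g => (g <= m i)%MM) s).
have hf i : (i < size (msupp p))%N -> generated_by s (m i).
  by move=> hi; apply/hp/mem_nth.
exists (size (msupp p)), (fun i => p@_(m i) *: 'X_[m i - f i]), (fun i =>
  'X_[f i]).
split=> [i|]; first by apply/map_f/mem_nth; rewrite -has_find; exact: hf.
rewrite {1}[p]mpolyE (big_nth 0%MM) big_mkord; apply: eq_bigr => i _.
by rewrite -scalerAl -mpolyXD submK //; apply: (nth_find 0%MM (hf i _)).
Qed.

Lemma ideal_seq_monomial (s : seq 'X_{1..n}) (a : 'X_{1..n}) :
  ideal_seq (monomials K s) 'X_[a] <-> generated_by s a.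
Proof.
split=> [/ideal_seq_monomials|h]; first by apply; rewrite msuppX mem_head.
by apply/ideal_seq_monomials => m; rewrite msuppX inE => /eqP ->.
Qed.

Definition coprimem (f g : 'X_{1..n}) : bool :=
  [forall x, (f x == 0%N) || (g x == 0%N)].

Section MinimalGenerators.

Variables (I : S -> Prop) (s : seq 'X_{1..n}).
Hypothesis hs : minimal_monomial_generators I s.

Lemma minimal_generators_rem f g :
  f \in s -> g \in rem f s -> ~~ (g <= f)%MM.
Proof.
move=> fs gs; apply/negP => gf; case: hs => _ /(_ f fs); apply.
by apply/ideal_seq_monomial/hasP; exists g.
Qed.

(** If a variable [x] divides [g] and an earlier generator [f], then [g * (f / x)] is a multiple of
    [f]. Regularity puts [f / x] in the ideal of the generators before [g], so one of them divides
    [f / x]; it differs from [f] and divides [f], against minimality. *)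
Lemma regular_monomials_coprime :
  regular_seq (monomials K s) -> pairwise coprimem s.
Proof.
move=> hr; apply/(pairwiseP 0%MM) => i j; rewrite !inE => hi hj ij.
apply: contraT; rewrite negb_forall => /existsP[x].
set f := nth _ s i; set g := nth _ s j.
rewrite negb_or => /andP[fx gx].
have fs : f \in s by apply: mem_nth.
have /hr : (j < size (monomials K s))%N by rewrite size_map.
rewrite /monomials (nth_map 0%MM) // -map_take -/(monomials K _) -/g.
move=> /(_ 'X_[f - U_(x)]); rewrite -mpolyXD.
have h : generated_by (take j s) (g + (f - U_(x)))%MM.
  apply/hasP; exists f.
    by rewrite /f -(nth_take 0%MM ij) mem_nth // size_takel // ltnW.
  apply/mnm_lepP => y; rewrite mnmDE mnmBE mnm1E; case: eqP => [<-|_] /=; lia.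
case/(_ _)/ideal_seq_monomial/hasP; first exact/ideal_seq_monomial.
move=> e /mem_take es ef.
have ne : e != f.
  apply/eqP => h'; move: ef; rewrite h' => /mnm_lepP/(_ x).
  by rewrite mnmBE mnm1E eqxx; lia.
have := minimal_generators_rem fs (rem_mem ne es).
by rewrite (lepm_trans ef) // lem_subr.
Qed.

(** The monomial 1 divides every other generator, so minimality leaves it alone in the list, without
    repetition. *)
Lemma minimal_generators_neq0 : s = [:: 0%MM] \/ all (fun f => f != 0%MM) s.
Proof.
have l0 (f : 'X_{1..n}) : (0 <= f)%MM by apply/mnm_lepP => x; rewrite mnm0E.
have h f : f \in s -> 0%MM \notin rem f s.
  by move=> fs; apply/negP => /(minimal_generators_rem fs); rewrite l0.
case: s h => [|f [|g t]] h; [by right| |right].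
  by have [->|hf] := eqVneq f 0%MM; [left|right; rewrite /= hf].
apply/allP => e he; apply/eqP => e0; rewrite {}e0 in he.
move: (h f) (h g); rewrite /= !eqxx !inE !eqxx !orbT => /(_ isT).
move=> h1 /(_ isT); move: he h1; rewrite !inE.
case: (eqVneq f g) => [->|fg]; rewrite ?inE.
  by case: eqP => //= _; rewrite /= => ->.
by case: (eqVneq 0%MM f) => //=; case: (eqVneq 0%MM g) => //= _ _ ->.
Qed.

End MinimalGenerators.

Lemma mdeg_mlcm_le (f g : 'X_{1..n}) : (mdeg (mlcm f g) <= mdeg f + mdeg g)%N.
Proof. by rewrite -mdegD !mdegE leq_sum // => i _; rewrite mnmDE mnmE; lia. Qed.

Lemma mlcm_coprime (f g : 'X_{1..n}) : coprimem f g -> mlcm f g = (f + g)%MM.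
Proof.
move=> /forallP h; apply/mnmP => x; rewrite mnmDE mnmE.
by have /orP[/eqP ->|/eqP ->] := h x; rewrite ?max0n ?maxn0 ?addn0.
Qed.

(** The regularity for a nonempty list of coprime generators different from 1: the last Koszul shift
    is the sum of the degrees, in homological degree one less than their number. The unit ideal is
    treated apart. *)
Definition ci_reg (s : seq 'X_{1..n}) : nat := (\sum_(f <- s) (mdeg f).-1).+1.

(* The Taylor resolution, which is the Koszul complex in the coprime case. *)
Lemma taylor_resolution (s : seq 'X_{1..n}) :
  all (fun f => f != 0%MM) s -> pairwise coprimem s ->
  exists (P : 'X_{1..n} -> bool) (C : contractible K P),
    P =1 generated_by s /\
    [/\ forall e e' : basis C, bd e e' != 0 -> mndeg e' != mndeg e,
        forall e : basis C, mndeg e != 0%MM,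
        forall (e : basis C) x, mndeg e x != 0%N ->
          has (fun f : 'X_{1..n} => f x != 0%N) s,
        forall e : basis C, (mdeg (mndeg e) <= ci_reg s + hdeg e)%N
      & s != [::] -> exists e : basis C, mdeg (mndeg e) = (ci_reg s + hdeg
        e)%N].
Proof.
elim: s => [_ _|f s IH /andP[f0 s0] /andP[fs ss]].
  by exists (fun=> false), (void_contractible K n); split=> //; split=> // -[].
(* The statements on nonzero multidegrees and on supports strengthen the induction: [C0] gives
   minimality at the new generator, and [suppC] gives coprimality with [f], so that lcms become
   products and degrees add. *)
have [P [C [eP [minC C0 suppC leC topC]]]] := IH s0 ss.
have cop (e : basis C) : coprimem (mndeg e) f.
  apply/forallP => x; case: eqVneq => //= /suppC/hasP[g gs gx].
  by have /forallP/(_ x) := allP fs g gs; rewrite (negPf gx) orbF.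
have mndeg_gt0 (g : 'X_{1..n}) : g != 0%MM ->
  (0 < mdeg g)%N by rewrite lt0n mdeg_eq0.
have rE : ci_reg (f :: s) = ((mdeg f).-1 + ci_reg s)%N.
  by rewrite /ci_reg big_cons addnS.
have f1 := mndeg_gt0 f f0.
exists _, (cone_contractible C f); split.
  by move=> a; rewrite /= eP orbC.
split=> /=.
- case=> [e|[e|]] [e'|[e'|]] /=; rewrite ?eqxx // ?oppr_eq0.
  + exact: minC.
  + case: (eqVneq e e') => [<- _|_]; last by rewrite eqxx.
    rewrite mlcm_coprime //; apply: contraNneq f0 => h.
    by apply/eqP/(@addmI _ (mndeg e)); rewrite -h addm0.
  + move/minC; rewrite !mlcm_coprime //; apply: contra_neq.
    exact: addIm.
  + move=> _; rewrite mlcm_coprime //; apply: contraNneq (C0 e) => h.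
    by apply/eqP/(@addIm _ f); rewrite -h add0m.
- case=> [e|[e|]] //=; rewrite mlcm_coprime //.
  apply: contraNneq f0 => /(congr1 (@mdeg n)) /eqP.
  by rewrite mdegD mdeg0 addn_eq0 !mdeg_eq0 => /andP[].
- case=> [e|[e|]] x /=.
  + by move/suppC => ->; rewrite orbT.
  + rewrite mlcm_coprime // mnmDE addn_eq0 negb_and => /orP[/suppC -> |->//].
    by rewrite orbT.
  + by move=> ->.
- case=> [e|[e|]] /=; rewrite rE.
  + by have := leC e; lia.
  + by have := leC e; rewrite mlcm_coprime // mdegD; lia.
  + by rewrite /ci_reg; lia.
(* The bound is attained by [f] itself if it is the only generator, otherwise by [f] joined to an
   element attaining the previous bound. *)
- move=> _; rewrite rE; case: (eqVneq s [::]) topC => [-> _|_ /(_ isT)[e he]].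
    by exists (inr None); rewrite /ci_reg big_nil /=; lia.
  by exists (inr (Some e)); rewrite /= mlcm_coprime // mdegD he; lia.
Qed.

(** * Regularity bounds from multigraded resolutions *)

Section RegularityBounds.

Variables (I : S -> Prop) (P : 'X_{1..n} -> bool) (C : contractible K P).
Hypothesis hI : forall p, I p <-> monomial_span P p.

Lemma resolves_homogenization : resolves (homogenization C) I.
Proof.
case: (homogenization_resolves C) => h0 h1 h2; split=> // p.
by split=> [/hI /h0|/h0 /hI].
Qed.

(** The value [s] comes from a shift of a minimal resolution, and that shift occurs in the same
    homological degree of [homogenization C]. *)
Lemma is_reg_le (r s : int) :
  (forall e : basis C, (mdeg (mndeg e))%:Z <= r + (hdeg e)%:Z) ->
    is_reg I s -> s <= r.
Proof.
move=> hr [F [[gF _ rF mF] [i [j ->]] _]].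
have [k <-] := minimal_resolution_shift j gF rF mF (homogenization_graded C)
  resolves_homogenization.
by rewrite lerBlDr (le_trans (hr _)) // level_hdeg.
Qed.

(** Nonnegativity of [r] covers the default value 0 of [reg]. *)
Lemma reg_le (r : int) : 0 <= r ->
  (forall e : basis C, (mdeg (mndeg e))%:Z <= r + (hdeg e)%:Z) -> reg I <= r.
Proof.
rewrite /reg; case: excluded_middle_informative => //= h _ hr.
by case: constructive_indefinite_description => s /=; apply: is_reg_le.
Qed.

(** Here [homogenization C] is itself minimal, which rules out the default value of [reg]. The
    chosen regularity may come from another resolution, but the extremal shift of [C] occurs there
    as well. *)
Lemma reg_ge (r : nat) :
  (forall e e' : basis C, bd e e' != 0 -> mndeg e' != mndeg e) ->
  (forall e : basis C, (mdeg (mndeg e) <= r + hdeg e)%N) ->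
  (exists e : basis C, mdeg (mndeg e) = (r + hdeg e)%N) ->
  r%:Z <= reg I.
Proof.
move=> minC leC [e he].
have [j ej] := level_ev (erefl (hdeg e)).
have mF := homogenization_minimal minC.
have rF := resolves_homogenization; have gF := homogenization_graded C.
have ex : exists r, is_reg I r.
  exists r%:Z, (homogenization C); split.
  - by split=> //; apply: homogenization_finite_length.
  - by exists (hdeg e), j; rewrite /= -ej he PoszD addrK.
  - by move=> i k; rewrite lerBlDr /= -PoszD lez_nat -[i in (r +
      i)%N](level_hdeg k).
rewrite /reg; case: excluded_middle_informative => //= h.
case: constructive_indefinite_description => s /= [G [[gG _ rG _] _ leG]].
have [k hk] := minimal_resolution_shift j gF rF mF gG rG.
by apply: le_trans (leG _ k); rewrite hk /= -ej he PoszD addrK.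
Qed.

End RegularityBounds.

Lemma complete_intersection_resolution (I : S -> Prop) :
  monomial_complete_intersection I ->
  exists (P : 'X_{1..n} -> bool) (C : contractible K P),
    [/\ forall p, I p <-> monomial_span P p, 0 <= reg I
      & forall e : basis C, (mdeg (mndeg e))%:Z <= reg I + (hdeg e)%:Z].
Proof.
case=> _ [p Ip p0] [s hs /(regular_monomials_coprime hs) cop].
have hI q : I q <-> monomial_span (generated_by s) q.
  case: hs => hs _.
  by split=> [/hs/ideal_seq_monomials|/ideal_seq_monomials/hs].
have s0 : s != [::].
  apply: contraNneq p0 => s0; apply/eqP/msuppnil0.
  move: ((hI p).1 Ip); rewrite s0 /monomial_span.
  by case: (msupp p) => // m t /(_ m); rewrite mem_head => /(_ isT).
suff [P [C [r [eP minC leC topC]]]] :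
    exists (P : 'X_{1..n} -> bool) (C : contractible K P) (r : nat),
    [/\ P =1 generated_by s, forall e e' : basis C, bd e e' != 0 ->
      mndeg e' != mndeg e,
      forall e : basis C, (mdeg (mndeg e) <= r + hdeg e)%N
    & exists e : basis C, mdeg (mndeg e) = (r + hdeg e)%N].
  have hIP q : I q <-> monomial_span P q.
    split=> [/hI h m /h|h]; first by rewrite eP.
    by apply/hI => m /h; rewrite eP.
  (* Both remaining claims hold with [r] in place of [reg I], and pass to [reg I] by
     monotonicity. *)
  have rI := reg_ge hIP minC leC topC.
  exists P, C; split=> // [|e]; first exact: le_trans rI.
  by rewrite (le_trans _ (lerD rI (lexx _))) // -PoszD lez_nat.
case: (minimal_generators_neq0 hs) => [->|sn0].
  exists (fun=> true), (unit_contractible K n), 0%N; split=> /=.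
  - by move=> a; rewrite /generated_by /= orbF; apply/esym/mnm_lepP => x;
      rewrite mnm0E.
  - by move=> _ _; rewrite eqxx.
  - by move=> _; rewrite mdeg0.
  - by exists tt; rewrite mdeg0.
have [P [C [eP [minC _ _ leC topC]]]] := taylor_resolution sn0 cop.
by exists P, C, (ci_reg s); split=> //; apply: topC.
Qed.

(** Induction on [d] from the empty intersection, the unit ideal with bound 0; each further ideal is
    intersected by a product of complexes. *)
Lemma intersection_resolution (d : nat) (I : 'I_d -> S -> Prop)
    (r : 'I_d -> int) :
  (forall k, exists (P : 'X_{1..n} -> bool) (C : contractible K P),
    (forall p, I k p <-> monomial_span P p) /\
    (forall e : basis C, (mdeg (mndeg e))%:Z <= r k + (hdeg e)%:Z)) ->
  exists (P : 'X_{1..n} -> bool) (C : contractible K P),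
    (forall p, (forall k, I k p) <-> monomial_span P p) /\
    (forall e : basis C, (mdeg (mndeg e))%:Z <= \sum_(k < d) r k + (hdeg e)%:Z).
Proof.
elim: d I r => [|d IH] I r hI.
  exists (fun=> true), (unit_contractible K n).
  split=> [p|e]; first by split=> // _ [].
  by rewrite big_ord0 /= mdeg0.
have [P [C [eC leC]]] := hI ord_max.
have [Q [D [eD leD]]] := IH (fun k => I (widen_ord (leqnSn d) k))
  (fun k => r (widen_ord (leqnSn d) k)) (fun k => hI _).
exists _, (prod_contractible D C); split=> [p|[e e']] /=.
  split=> [h m hm|h k].
    apply/andP; split; first by apply: ((eD p).1 _ m hm) => k; apply: h.
    exact: ((eC p).1 (h _) m hm).
  have [[k' ->]|->] : (exists k', k = widen_ord (leqnSn d) k') \/ k = ord_max.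
    have [kd|kd] := ltnP k d; [left; exists (Ordinal kd)|right].
      exact/val_inj.
    by apply/val_inj/anti_leq; rewrite /= kd -ltnS ltn_ord.
    by apply: (eD p).2 => m /h /andP[].
  by apply: (eC p).2 => m /h /andP[].
(* Homological degrees add exactly, whereas the degree of an lcm is at most the sum of degrees. *)
rewrite big_ord_recr /=; have := lerD (leD e) (leC e').
rewrite PoszD addrACA; apply: le_trans.
by rewrite -PoszD lez_nat mdeg_mlcm_le.
Qed.

End MonomialIdeals.

Theorem theorem3p3 (K : fieldType) (n d : nat) (hd : (1 <= d)%N)
    (I : 'I_d -> {mpoly K[n]} -> Prop)
    (hI : forall k, monomial_complete_intersection (I k)) :
  reg (fun p : {mpoly K[n]} => forall k, I k p) <= \sum_(k < d) reg (I k).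
Proof.
have [k|P [C [eP leC]]] :=
    intersection_resolution (I := I) (r := fun k => reg (I k)).
  have [P [C [h1 _ h2]]] := complete_intersection_resolution (hI k).
  by exists P, C.
(* The bound is nonnegative because each summand is. *)
apply: (reg_le (C := C) eP) leC; apply: sumr_ge0 => k _.
by have [P' [C' []]] := complete_intersection_resolution (hI k).
Qed.
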